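(* Let $X$ be a Banach space and let $(A(t),D(A(t)))_{t\in\mathbb{R}}$ be a family of linear operators on $X$ with the following properties. (a) There exist $K\ge 1$ and $\omega\in\mathbb{R}$ such that $\|e^{tA(r)}\|\le K e^{\omega t}$ for all $r\in\mathbb{R}$ and $t\ge 0$. Further, $A(t)=A+V(t)$ for all $t\in\mathbb{R}$, where $A$ is the generator of a strongly continuous semigroup on $X$ and $V(t)\in\mathcal{L}(X)$ for all $t\in\mathbb{R}$. (b) (Well-posedness) The non-autonomous Cauchy problem associated to $(A(t))_{t\in\mathbb{R}}$ is well-posed, i.e., there is an evolution family $(U(t,s))_{t\ge s}$ solving it, and it satisfies $\|U(t,s)\|\le K e^{\omega(t-s)}$ for all $t\ge s$. (c) (Stability) There are constants $M\ge 1$ and $\omega'\in\mathbb{R}$ such that for all $t>s$ in $\mathbb{R}$, all $n\in\mathbb{N}$ and all $k=0,1,\dots,n-1$, $$\Bigl\|\prod_{j=0}^{k} e^{\frac{t-s}{n}A\left(s+\frac{(2j+1)(t-s)}{2n}\right)}\Bigr\|\le M e^{\frac{(k+1)\omega'(t-s)}{n}}.$$ (d) (Local Hölder continuity) There exists $\alpha\in(0,1]$ such that for every $T>0$ there is $L=L(T)>0$ with $$\|A(t)-A(s)\|\le L|t-s|^{\alpha}\quad\text{for all } t,s\in(-T,T),$$ where $A(t)-A(s)$ is understood as the bounded operator $V(t)-V(s)$. Then for all $t,s\in\mathbb{R}$ with $t>s$ there is $C\ge 1$ such that $$\Bigl\|U(t,s)-\prod_{k=0}^{n-1}e^{\frac{t-s}{n}A\left(s+(2k+1)\frac{t-s}{2n}\right)}\Bigr\|\le\frac{C}{n^{\alpha}}$$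 for all $n\in\mathbb{N}$.
   Context: $\mathbb{N}=\{1,2,\dots\}$; $\mathcal{L}(X)$ is the space of bounded linear operators on $X$ with the operator norm. For a generator $B$ of a strongly continuous semigroup ($C_0$-semigroup), $(e^{tB})_{t\ge0}$ denotes that semigroup. Each $A(t)=A+V(t)$ has domain $D(A)$. Products are time-ordered: $\prod_{k=0}^{n-1}L_k:=L_{n-1}L_{n-2}\cdots L_0$ for $L_k\in\mathcal{L}(X)$; an empty product is the identity $I$. For $s\in\mathbb{R}$ and $x\in X$, the non-autonomous Cauchy problem $(\mathrm{NCP}_{s,x})$ is $\frac{d}{dt}u(t)=A(t)u(t)$ for $t\ge s$, $u(s)=x$. A (classical) solution is a function $u\in C^1([s,\infty);X)$ with $u(t)\in D(A(t))$ for all $t\ge s$, $u(s)=x$, and $\frac{d}{dt}u(t)=A(t)u(t)$ for all $t\ge s$. An (exponentially bounded) evolution family is a family $(U(t,s))_{t\ge s}$ in $\mathcal{L}(X)$ such that: (i) $U(t,r)U(r,s)=U(t,s)$ and $U(t,t)=I$ for all $t\ge r\ge s$; (ii) $(t,s)\mapsto U(t,s)$ is strongly continuous; (iii) $\|U(t,s)\|\le M_0e^{\omega_0(t-s)}$ for all $t\ge s$, for some $M_0\ge1$, $\omega_0\in\mathbb{R}$. It solves the non-autonomous Cauchy problem if for every $s\in\mathbb{R}$ the subspace $Y_s:=\{y\in X: t\mapsto U(t,s)y \text{ on } [s,\infty)\text{ is a classical solution of }(\mathrm{NCP}_{s,y})\}$ is dense in $X$. The non-autonomous Cauchy problem is well-posed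 (with exponentially bounded solutions) if: for every $s$ the set $Y_s$ of all $y\in X$ for which $(\mathrm{NCP}_{s,y})$ has a classical solution is dense in $X$; for $y\in Y_s$ the solution $u_s(\cdot,y)$ is unique; if $s_n\to s$ and $y_n\to y$ in $X$ with $y_n\in Y_{s_n}$, $y\in Y_s$, then $\hat u_{s_n}(t,y_n)\to\hat u_s(t,y)$ uniformly for $t$ in compact subsets of $\mathbb{R}$, where $\hat u_r(t,y)=u_r(t,y)$ for $t\ge r$ and $\hat u_r(t,y)=y$ for $t<r$; and there are $M_0\ge1$, $\omega_0\in\mathbb{R}$ with $\|u_s(t,y)\|\le M_0e^{\omega_0(t-s)}\|y\|$ for all $y\in Y_s$, $t\ge s$. It is a known fact that this is equivalent to the existence of a unique evolution family solving the non-autonomous Cauchy problem. *)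

(* Defs.v *)
From HB Require Import structures.
From mathcomp Require Import all_boot all_order all_algebra.
From mathcomp Require Import all_classical all_reals all_analysis.

Set Implicit Arguments.
Unset Strict Implicit.
Unset Printing Implicit Defensive.

Import Order.TTheory GRing.Theory Num.Theory.
Import numFieldNormedType.Exports.

Local Open Scope classical_set_scope.
Local Open Scope ring_scope.

(* Banach spaces are taken over the reals. This covers the complex ones by
   restriction of scalars: norms, limits, derivatives and hence generators and
   semigroups do not see the complex structure. *)

Record bounded_operator (R : realType) (X : normedModType R) := BoundedOperator {
  bounded_operator_fun :> {linear X -> X};
  bounded_operator_continuous : continuous bounded_operator_fun
}.

(* Operator norm. [sup] is junk (0) on unbounded sets, so this is only
   meaningful when [T] is a bounded linear operator. *)
Definition opnorm (R : realType) (X : normedModType R) (T : X -> X) : R :=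
  sup [set `|T x| | x in [set x : X | `|x| <= 1]].

(* [L n.-1 \o ... \o L 1 \o L 0] *)
Definition time_ordered_prod (X : Type) (n : nat) (L : nat -> X -> X) : X -> X :=
  iteri n (fun k P => L k \o P) idfun.

(* The values of [op_fun] outside of [op_dom] carry no meaning. *)
Record operator (R : realType) (X : normedModType R) := Operator {
  op_dom : set X;
  op_fun : X -> X;
  op_dom0 : op_dom 0;
  op_domP : forall (a : R) x y, op_dom x -> op_dom y -> op_dom (a *: x + y);
  op_linear : forall (a : R) x y, op_dom x -> op_dom y ->
    op_fun (a *: x + y) = a *: op_fun x + op_fun y
}.

Definition perturb_fun (R : realType) (X : normedModType R) (A : operator X)
    (V : bounded_operator X) (x : X) : X :=
  op_fun A x + V x.

Lemma perturb_linear (R : realType) (X : normedModType R) (A : operator X)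
    (V : bounded_operator X) (a : R) x y : op_dom A x -> op_dom A y ->
  perturb_fun A V (a *: x + y) = a *: perturb_fun A V x + perturb_fun A V y.
Proof.
by move=> Ax Ay; rewrite /perturb_fun op_linear// linearP scalerDr addrACA.
Qed.

(* [A + V], with domain [op_dom A] *)
Definition perturb (R : realType) (X : normedModType R) (A : operator X)
    (V : bounded_operator X) : operator X :=
  Operator (op_dom0 A) (@op_domP _ _ A) (@perturb_linear _ _ A V).

(* The operators [S t] with [t < 0] are unconstrained. *)
Definition C0_semigroup (R : realType) (X : normedModType R)
    (S : R -> bounded_operator X) : Prop :=
  [/\ forall x, S 0 x = x,
      forall t r x, 0 <= t -> 0 <= r -> S (t + r) x = S t (S r x)
    & forall x, {within [set t : R | 0 <= t], continuous (fun t => S t x)}].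

(* [S] is the (unique) C0-semigroup [e^{tB}]: [B] is exactly the right
   derivative at 0 of the orbits, on exactly the vectors where it exists. *)
Definition generates (R : realType) (X : normedModType R) (B : operator X)
    (S : R -> bounded_operator X) : Prop :=
  C0_semigroup S /\
  forall x y, op_dom B x /\ op_fun B x = y <->
    h^-1 *: (S h x - x) @[h --> 0^'+] --> y.

(* [v] is the derivative of [u : [s, +oo) -> X] at [t]; this is a one-sided
   derivative when [t = s]. *)
Definition halfline_derivative (R : realType) (X : normedModType R) (s : R)
    (u : R -> X) (t : R) (v : X) : Prop :=
  h^-1 *: (u (t + h) - u t) @[h --> within [set h | s <= t + h] 0^'] --> v.

Definition classical_solution (R : realType) (X : normedModType R)
    (A : R -> operator X) (s : R) (x : X) (u : R -> X) : Prop :=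
  exists u' : R -> X,
    [/\ forall t, s <= t -> halfline_derivative s u t (u' t),
        {within [set t | s <= t], continuous u'},
        forall t, s <= t -> op_dom (A t) (u t),
        u s = x
      & forall t, s <= t -> u' t = op_fun (A t) (u t)].

(* The operators [U t s] with [t < s] are unconstrained. *)
Definition evolution_family (R : realType) (X : normedModType R)
    (U : R -> R -> bounded_operator X) : Prop :=
  [/\ forall t r s x, s <= r -> r <= t -> U t r (U r s x) = U t s x,
      forall t x, U t t x = x,
      forall x, {within [set p : R * R | p.2 <= p.1],
                 continuous (fun p => U p.1 p.2 x)}
    & exists M0 w0 : R, 1 <= M0 /\
        forall t s, s <= t -> opnorm (U t s) <= M0 * expR (w0 * (t - s))].

Definition solves_NCP (R : realType) (X : normedModType R)
    (A : R -> operator X) (U : R -> R -> bounded_operator X) : Prop :=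
  forall s, dense [set y | classical_solution A s y (fun t => U t s y)].

Definition solvable_at (R : realType) (X : normedModType R)
    (A : R -> operator X) (s : R) : set X :=
  [set y | exists u, classical_solution A s y u].

(* the function written [\hat u_s(., y)], constantly [y] before time [s] *)
Definition extend_left (R : realType) (X : normedModType R) (s : R) (y : X)
    (u : R -> X) (t : R) : X :=
  if s <= t then u t else y.

Definition well_posed (R : realType) (X : normedModType R)
    (A : R -> operator X) : Prop :=
  [/\ forall s, dense (solvable_at A s),
      forall s y u v, classical_solution A s y u -> classical_solution A s y v ->
        forall t, s <= t -> u t = v t,
      forall (s_ : nat -> R) (s : R) (y_ : nat -> X) (y : X)
             (u_ : nat -> R -> X) (u : R -> X),
        s_ @ \oo --> s -> y_ @ \oo --> y ->
        (forall n, classical_solution A (s_ n) (y_ n) (u_ n)) ->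
        classical_solution A s y u ->
        forall J : set R, compact J ->
          {uniform J, (fun n => extend_left (s_ n) (y_ n) (u_ n)) @ \oo -->
                      extend_left s y u}
    & exists M0 w0 : R, 1 <= M0 /\
        forall s y u, classical_solution A s y u ->
          forall t, s <= t -> `|u t| <= M0 * expR (w0 * (t - s)) * `|y|].

(* Main.v *)
Require Import Defs.
From HB Require Import structures.
From mathcomp Require Import all_boot all_order all_algebra.
From mathcomp Require Import all_classical all_reals all_analysis.
From mathcomp Require Import ring lra.

Set Implicit Arguments.
Unset Strict Implicit.

Import Order.TTheory GRing.Theory Num.Theory.
Import numFieldNormedType.Exports.

Local Open Scope classical_set_scope.
Local Open Scope ring_scope.

(** Write [h = (t - s) / n], [p_k = s + k h], [m_k] for the midpoint of
    [p_k, p_{k+1}], and [P_k] for the product of the first [k] exponentials.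
    The error telescopes as
      [U(t,s) - P_n
        = \sum_{k < n} U(t,p_{k+1}) (U(p_{k+1},p_k) - e^{h A(m_k)}) P_k].
    The factors [U(t,p_{k+1})] are bounded by the exponential bound on [U], and
    the factors [P_k] by stability, both uniformly in [k] and [n]; this is
    [telescoped_error]. So it suffices that each one-step defect is
    [O(h^(1+alpha))]: summing [n = (t-s)/h] of them leaves
    [O(h^alpha) = O(n^(-alpha))].

    One step on [a, b] with frozen time [m] is Duhamel's formula. If
    [u r = U(r,a) y] is a classical solution, then [g r = e^{(b-r)A(m)} (u r)]
    joins [e^{(b-a)A(m)} y] to [U(b,a) y], and its derivative
    [e^{(b-r)A(m)} (A(r) - A(m)) (u r)] contains only the bounded operator
    [V(r) - V(m)], of norm at most [L h^alpha] by Hoelder continuity. The mean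
    value inequality then bounds the defect ([generator_defect]). It is used in the form [right_lipschitz_le], for a left continuous function with
    bounded right difference quotients, because these quotients of [g] can be
    read off from the semigroup law without a product rule. The initial values
    [y] of classical solutions are only dense, but the resulting estimate is between bounded operators, so it
    extends to all of [X] ([dense_le_norm], [evolution_step_defect]). *)

(** * Pointwise bounds and the operator norm *)

(** [T] is any homogeneous map, so that differences and products of operators
    are covered; the bound [c] makes the supremum defining [opnorm T] a genuine
    one. *)
Lemma le_opnorm (R : realType) (X : normedModType R) (T : X -> X) (c : R)
    (x : X) :
  (forall a y, T (a *: y) = a *: T y) -> (forall y, `|T y| <= c * `|y|) ->
  `|T x| <= opnorm T * `|x|.
Proof.
move=> TZ Tc.
have [->|x0] := eqVneq x 0.
  by rewrite -(scale0r 0) TZ !scale0r !normr0 mulr0.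
have nx0 : 0 < `|x| by rewrite normr_gt0.
rewrite -ler_pdivrMr//; apply: ub_le_sup.
  exists `|c| => _ [y /= y1 <-]; apply: (le_trans (Tc y)).
  rewrite (le_trans (ler_wpM2r _ (ler_norm c)))// ler_piMr//.
exists (`|x|^-1 *: x) => /=; last by rewrite TZ normrZ normfV normr_id mulrC.
by rewrite normrZ normfV normr_id mulVf// gt_eqF.
Qed.

Lemma bounded_operator_bounded (R : realType) (X : normedModType R)
    (T : bounded_operator X) : exists c : R, forall x, `|T x| <= c * `|x|.
Proof.
have /linear_bounded_continuous/linear_boundedP :=
  @bounded_operator_continuous _ _ T.
by case=> M [_ h]; exists (M + 1); apply: h; rewrite ltrDl.
Qed.

Lemma le_opnorm_bounded (R : realType) (X : normedModType R)
    (T : bounded_operator X) (x : X) : `|T x| <= opnorm T * `|x|.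
Proof.
have [c hc] := bounded_operator_bounded T.
by apply: le_opnorm hc => a y; rewrite linearZ.
Qed.

Lemma le_opnorm_sub (R : realType) (X : normedModType R)
    (S T : bounded_operator X) (x : X) :
  `|S x - T x| <= opnorm (fun y => S y - T y) * `|x|.
Proof.
have [c hc] := bounded_operator_bounded S.
have [d hd] := bounded_operator_bounded T.
apply: (le_opnorm (T := fun y => S y - T y) (c := c + d)) => [a y|y].
  by rewrite !linearZ/= -scalerDr.
by rewrite mulrDl (le_trans (ler_normB _ _))// lerD.
Qed.

Lemma le_opnorm_time_ordered_prod (R : realType) (X : normedModType R)
    (L : nat -> bounded_operator X) (n : nat) (x : X) :
  `|time_ordered_prod n L x| <= opnorm (time_ordered_prod n L) * `|x|.
Proof.
suff [c hc] : exists c : R, forall y, `|time_ordered_prod n L y| <= c * `|y|.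
  apply: le_opnorm hc => a y; elim: n => [//|n IHn] /=.
  by rewrite IHn linearZ.
elim: n => [|n [c hc]]; first by exists 1 => y; rewrite mul1r.
have [d hd] := bounded_operator_bounded (L n).
exists (`|d| * c) => y /=; rewrite (le_trans (hd _))// -mulrA.
by rewrite (le_trans (ler_wpM2r _ (ler_norm d)))// ler_wpM2l.
Qed.

Lemma opnorm_le (R : realType) (X : normedModType R) (T : X -> X) (c : R) :
  0 <= c -> (forall x, `|T x| <= c * `|x|) -> opnorm T <= c.
Proof.
move=> c0 Tc; apply: ge_sup; first by exists `|T 0|, 0 => //=; rewrite normr0.
by move=> _ [x /= x1 <-]; rewrite (le_trans (Tc x))// ler_piMr.
Qed.

(** The set where the estimate fails is open, hence would meet [D]. *)
Lemma dense_le_norm (R : realType) (X : normedModType R)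
    (S T : bounded_operator X) (D : set X) (c : R) :
  dense D -> (forall y, D y -> `|S y - T y| <= c * `|y|) ->
  forall x, `|S x - T x| <= c * `|x|.
Proof.
move=> dD hD x; rewrite leNgt; apply/negP => hx.
pose f y := `|S y - T y| - c * `|y|.
have fc : continuous f.
  move=> y; apply: cvgB.
    by apply: cvg_norm; apply: cvgB; apply: bounded_operator_continuous.
  by apply: cvgM; [exact: cvg_cst | apply: cvg_norm; exact: cvg_id].
have fo : open (f @^-1` [set r | 0 < r]).
  by apply: open_comp => [y _|]; [exact: fc | exact: open_gt].
have [|y [/= fy Dy]] := dD _ _ fo; first by exists x; rewrite /f /= subr_gt0.
by move: fy; rewrite /f subr_gt0 ltNge hD.
Qed.

(** * A one-sided mean value inequality *)

(** Fix [e > 0] and let [p] be the supremum of the [r] in [a, b] such that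
    [`|g r - g a| <= (c + e) * (r - a)]. By left continuity this still holds at
    [p], and if [p < b] the bound on the right difference quotients at [p] would
    carry it beyond [p]. The slack [e] in the hypothesis is what a limit of
    difference quotients of norm at most [c] provides. *)
Lemma right_lipschitz_le (R : realType) (X : normedModType R) (g : R -> X)
    (a b c : R) : a <= b ->
  (forall r, a < r <= b -> g x @[x --> r^'-] --> g r) ->
  (forall r e, a <= r < b -> 0 < e ->
    \forall h \near 0^'+, `|g (r + h) - g r| <= (c + e) * h) ->
  `|g b - g a| <= c * (b - a).
Proof.
move=> ab gl gr.
suff H e : 0 < e -> `|g b - g a| <= (c + e) * (b - a).
  apply/ler_addgt0Pr => e e0.
  have ba0 : 0 < b - a + 1 by rewrite ltr_wpDl// subr_ge0.
  rewrite (le_trans (H _ (divr_gt0 e0 ba0)))// mulrDl lerD2l.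
  by rewrite mulrAC ler_pdivrMr// ler_wpM2l ?(ltW e0)// lerDl.
move=> e0.
pose S := [set r | a <= r <= b /\ `|g r - g a| <= (c + e) * (r - a)].
have Sa : S a by split; [rewrite lexx | rewrite !subrr normr0 mulr0].
have Sub : has_ubound S by exists b => r [/andP[]].
have hS : has_sup S by split => //; exists a.
have ap : a <= sup S by exact: ub_le_sup.
have pb : sup S <= b by apply: ge_sup; [exists a | move=> r [/andP[]]].
have Sp : S (sup S).
  split; first by rewrite ap.
  have [->|pa] := eqVneq (sup S) a; first by rewrite !subrr normr0 mulr0.
  have {}pa : a < sup S by rewrite lt_neqAle eq_sym pa.
  (* otherwise the strict failure at the supremum spreads to its left, away
     from all points of S *)
  rewrite leNgt; apply/negP => hp.
  pose f r := `|g r - g a| - (c + e) * (r - a).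
  have fl : f x @[x --> (sup S)^'-] --> f (sup S).
    have idl : (x : R) @[x --> (sup S)^'-] --> sup S.
      exact: cvg_at_left_filter (cvg_id).
    apply: cvgB.
      by apply: cvg_norm; apply: cvgB; [apply: gl; rewrite pa | exact: cvg_cst].
    by apply: cvgM; [exact: cvg_cst | apply: cvgB => //; exact: cvg_cst].
  have fp : 0 < f (sup S) by rewrite subr_gt0.
  have : \forall x \near (sup S)^'-, 0 < f x by exact: (cvgr_gt _ fl).
  rewrite /at_left near_withinE => -[d /= d0 hd].
  have [r Sr pr] := sup_adherent d0 hS.
  have rp : r <= sup S by exact: ub_le_sup.
  have [rE|rN] := eqVneq r (sup S).
    by case: Sr => _; rewrite rE leNgt hp.
  have : 0 < f r.
    by apply: hd; rewrite /= ?lt_neqAle ?rN// ger0_norm ?subr_ge0//; lra.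
  by case: Sr => _ ?; rewrite subr_gt0 ltNge; apply/negP/negPn.
have [<-|pN] := eqVneq (sup S) b; first by case: Sp.
have {}pN : sup S < b by rewrite lt_neqAle pN.
have hb : \forall h \near (0 : R)^'+, h < b - sup S.
  by apply: nbhs_right_lt; rewrite subr_gt0.
have hr : \forall h \near 0^'+, `|g (sup S + h) - g (sup S)| <= (c + e) * h.
  by apply: gr => //; rewrite ap.
have h0 : \forall h \near (0 : R)^'+, 0 < h by exact: nbhs_right_gt.
have [h [[hhb hhr] hh0]] := filter_ex (filterI (filterI hb hr) h0).
suff : S (sup S + h) by move/(ub_le_sup Sub); lra.
split; first by apply/andP; split; lra.
have -> : g (sup S + h) - g a = (g (sup S + h) - g (sup S)) + (g (sup S) - g a).
  by rewrite addrA subrK.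
case: Sp => _ /(lerD hhr) /(le_trans (ler_normD _ _)) /le_trans; apply.
by rewrite -mulrDr [h + _]addrC addrAC.
Qed.

(** * Comparing a curve with a semigroup *)

Lemma within_continuous_cvg (I : Type) (F : set_system I) (T Y : topologicalType)
    (D : set T) (f : T -> Y) (phi : I -> T) (y : T) : Filter F ->
  {within D, continuous f} -> D y -> (\forall i \near F, D (phi i)) ->
  phi i @[i --> F] --> y -> f (phi i) @[i --> F] --> f y.
Proof.
move=> FF /subspace_continuousP/(_ y) fc Dy DF phiy.
apply: cvg_trans (fc Dy) => W WF.
have FW : F (phi @^-1` [set t | D t -> W (f t)]) by exact: (phiy _ WF).
by apply: (filterS _ (filterI FW DF)) => i [/= h Di]; exact: h.
Qed.

(** The curve [g r = S (b - r) (u r)] runs from [S (b - a) (u a)] to [u b], and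
      [g (r + h) - g r = S (b - r - h) (u (r + h) - S h (u r))].
    Divided by [h], the argument of the semigroup tends to [v r - B (u r)], whose
    norm is at most [d]; hence [N * d] is an asymptotic bound on the right
    difference quotients of [g]. *)
Lemma generator_defect (R : realType) (X : normedModType R) (B : operator X)
    (S : R -> bounded_operator X) (u v : R -> X) (a b N d : R) :
  generates B S -> a <= b -> 0 <= N ->
  (forall t x, 0 <= t <= b - a -> `|S t x| <= N * `|x|) ->
  (forall r, a < r <= b -> u x @[x --> r^'-] --> u r) ->
  (forall r, a <= r < b -> h^-1 *: (u (r + h) - u r) @[h --> 0^'+] --> v r) ->
  (forall r, a <= r < b -> op_dom B (u r)) ->
  (forall r, a <= r < b -> `|v r - op_fun B (u r)| <= d) ->
  `|u b - S (b - a) (u a)| <= N * d * (b - a).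
Proof.
move=> [[S0 SD Sc] gen] ab N0 SN ul ur uB ud.
pose g r := S (b - r) (u r).
suff : `|g b - g a| <= N * d * (b - a) by rewrite /g subrr S0.
apply: right_lipschitz_le => // [r /andP[ar rb]|r e /andP[ar rb] e0].
  (* [S] is only strongly continuous, so the variation of its argument is
     treated separately, using the uniform bound [N] *)
  have Sl : S (b - x) (u r) @[x --> r^'-] --> S (b - r) (u r).
    apply: (within_continuous_cvg (f := fun t => S t (u r)) _ (Sc (u r))).
    - by rewrite /= subr_ge0.
    - have : \forall x \near r^'-, x < r by exact: nbhs_left_lt.
      by apply: filterS => x xr /=; lra.
    - by apply: cvgB; [exact: cvg_cst | exact: cvg_at_left_filter (cvg_id)].
  have Sd : S (b - x) (u x - u r) @[x --> r^'-] --> (0 : X).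
    apply/cvgr0Pnorm_le => e e0.
    have N1 : 0 < N + 1 by rewrite ltr_wpDl.
    have rr : a < r <= b by rewrite ar.
    have /cvgrPdist_le/(_ _ (divr_gt0 e0 N1)) hu := ul r rr.
    have ha : \forall x \near r^'-, a < x by exact: nbhs_left_gt.
    have hr : \forall x \near r^'-, x < r by exact: nbhs_left_lt.
    apply: filterS (filterI (filterI hu ha) hr) => x [[/= ux ax] xr].
    rewrite (le_trans (SN _ _ _))//; first by apply/andP; split; lra.
    rewrite distrC in ux; rewrite (le_trans (ler_wpM2l N0 ux))//.
    by rewrite mulrCA ler_piMr ?(ltW e0)// ler_pdivrMr// mul1r lerDl.
  have -> : g = fun x => S (b - x) (u x - u r) + S (b - x) (u r).
    by apply/funext => x; rewrite -linearD subrK.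
  by rewrite /= subrr linear0; apply: cvgD.
(* The slack [e] shrinks to [e / (N + 1)] to absorb the factor [N]. *)
have e'0 : 0 < e / (N + 1) by rewrite divr_gt0// ltr_wpDl.
have rr : a <= r < b by rewrite ar.
have [gS _] := gen (u r) (op_fun B (u r)).
have {gS}qc := cvgB (ur r rr) (gS (conj (uB r rr) erefl)).
have qd : `|v r - op_fun B (u r)| < d + e / (N + 1).
  by rewrite (le_lt_trans (ud r rr))// ltrDl.
have near_q := cvgr_norm_le _ (qc _) _ qd.
near=> h.
have h0 : 0 < h by near: h; exact: nbhs_right_gt.
have hb : h < b - r by near: h; apply: nbhs_right_lt; rewrite subr_gt0.
have hq : `|h^-1 *: (u (r + h) - u r) - h^-1 *: (S h (u r) - u r)| <=
    d + e / (N + 1) by near: h; exact: near_q.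
have -> : g (r + h) - g r = S (b - (r + h)) (u (r + h) - S h (u r)).
  rewrite /g linearB/= -SD ?(ltW h0)//; last lra.
  by congr (_ - S _ _); ring.
rewrite (le_trans (SN _ _ _))//; first by apply/andP; split; lra.
rewrite -scalerBr opprB addrA subrK normrZ gtr0_norm ?invr_gt0// in hq.
rewrite mulrC ler_pdivrMr// in hq.
rewrite (le_trans (ler_wpM2l N0 hq))// mulrA ler_wpM2r ?(ltW h0)//.
rewrite mulrDr lerD2l mulrCA ler_piMr ?(ltW e0)//.
by rewrite ler_pdivrMr ?ltr_wpDl// mul1r lerDl.
Unshelve. all: by end_near. Qed.

Lemma halfline_derivative_right (R : realType) (X : normedModType R) (s : R)
    (u : R -> X) (t : R) (v : X) : s <= t -> halfline_derivative s u t v ->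
  h^-1 *: (u (t + h) - u t) @[h --> 0^'+] --> v.
Proof.
move=> st; apply: cvg_trans => W.
rewrite /nbhs /= /within /= /at_right /dnbhs /within /=.
change (nbhs (0 : R) (fun h => h != 0 -> s <= t + h ->
    W (h^-1 *: (u (t + h) - u t))) ->
  nbhs (0 : R) (fun h => 0 < h -> W (h^-1 *: (u (t + h) - u t)))).
apply: filterS => h H h0; apply: H; first by rewrite gt_eqF.
by rewrite (le_trans st)// lerDl ltW.
Qed.

(** For a classical solution [u], [u' r - A(m) (u r) = V r (u r) - V m (u r)]:
    the unbounded parts cancel because all the [A(r)] share the operator [A] and
    its domain. *)
Lemma evolution_step_defect (R : realType) (X : normedModType R)
    (A : operator X) (V : R -> bounded_operator X)
    (S : R -> bounded_operator X) (U : R -> R -> bounded_operator X)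
    (a b m N d : R) :
  generates (perturb A (V m)) S -> evolution_family U ->
  solves_NCP (fun t => perturb A (V t)) U ->
  a <= b -> 0 <= N -> 0 <= d ->
  (forall t x, 0 <= t <= b - a -> `|S t x| <= N * `|x|) ->
  (forall r x, a <= r <= b -> `|U r a x| <= N * `|x|) ->
  (forall r x, a <= r <= b -> `|V r x - V m x| <= d * `|x|) ->
  forall x, `|U b a x - S (b - a) x| <= N * (d * N) * (b - a) * `|x|.
Proof.
move=> gS [_ U1 Uc _] Usol ab N0 d0 SN UN Vd.
apply: (dense_le_norm (Usol a)) => y [u' [ud _ udom uy u'E]].
have -> : N * (d * N) * (b - a) * `|y| = N * (d * (N * `|y|)) * (b - a) by ring.
rewrite -[in S _ y](U1 a y).
apply: (generator_defect (u := fun r => U r a y) (v := u') gS) => //.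
- move=> r /andP[ar rb].
  apply: (within_continuous_cvg (f := fun p => U p.1 p.2 y)
    (phi := fun x => (x, a)) (y := (r, a)) _ (Uc y)) => /=.
  + exact: ltW.
  + have : \forall x \near r^'-, a < x by exact: nbhs_left_gt.
    by apply: filterS => x; exact: ltW.
  + have idl : (x : R) @[x --> r^'-] --> r.
      exact: cvg_at_left_filter (cvg_id).
    have al : (a : R) @[x --> r^'-] --> a by exact: cvg_cst.
    exact: (cvg_pair idl al).
- move=> r /andP[ar rb]; exact: halfline_derivative_right (ud r ar).
- by move=> r /andP[ar rb]; exact: (udom r ar).
move=> r /andP[ar rb]; rewrite u'E//= /perturb_fun opprD addrACA subrr add0r.
rewrite (le_trans (Vd _ _ _)) ?ar ?(ltW rb)//.
by rewrite ler_wpM2l// UN// ar ltW.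
Qed.

(** * Accumulation of the one-step errors *)

(** The exact propagator is placed to the left of each one-step defect and the
    approximate one to the right. The latter are then products starting with
    factor [0], which are the ones that the stability hypothesis controls
    directly, and no constant is raised to the power [n]. *)
Lemma telescoped_error (R : realType) (X : normedModType R)
    (U : R -> R -> bounded_operator X) (L : nat -> bounded_operator X)
    (p : nat -> R) (n : nat) (N M e : R) :
  evolution_family U -> 0 <= N -> 0 <= e ->
  (forall k, (k < n)%N -> p k <= p k.+1) ->
  (forall k x, (k <= n)%N -> `|U (p n) (p k) x| <= N * `|x|) ->
  (forall k x, (k < n)%N -> `|time_ordered_prod k L x| <= M * `|x|) ->
  (forall k x, (k < n)%N -> `|U (p k.+1) (p k) x - L k x| <= e * `|x|) ->
  forall x, `|U (p n) (p 0%N) x - time_ordered_prod n L x|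
    <= n%:R * (N * e * M) * `|x|.
Proof.
move=> [Uc U1 _ _] N0 e0 pm UN LM UL x.
have pn k : (k <= n)%N -> p k <= p n.
  move=> kn; rewrite -(subKn kn); elim: (n - k)%N (leq_subr k n) => [|j IHj] jn.
    by rewrite subn0.
  apply: le_trans (IHj (ltnW jn)).
  have -> : (n - j = (n - j.+1).+1)%N by rewrite -subSn// subSS.
  by apply: pm; rewrite ltn_subrL (leq_ltn_trans _ jn).
(* [U (p n) (p k) P_k] interpolates between the two propagators. *)
suff H k : (k <= n)%N ->
    `|U (p n) (p 0%N) x - U (p n) (p k) (time_ordered_prod k L x)|
    <= k%:R * (N * e * M) * `|x|.
  by have := H n (leqnn n); rewrite U1.
elim: k => [|k IHk] kn; first by rewrite subrr normr0 !mul0r.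
set P := time_ordered_prod k L x.
have -> : time_ordered_prod k.+1 L x = L k P by [].
rewrite -natr1 !mulrDl mul1r.
have -> : U (p n) (p 0%N) x - U (p n) (p k.+1) (L k P) =
   (U (p n) (p 0%N) x - U (p n) (p k) P) +
   U (p n) (p k.+1) (U (p k.+1) (p k) P - L k P).
  by rewrite linearB/= Uc ?pm ?pn// addrA subrK.
rewrite (le_trans (ler_normD _ _))// lerD ?IHk ?(ltnW kn)//.
rewrite (le_trans (UN _ _ kn))// -!mulrA ler_wpM2l//.
by rewrite (le_trans (UL _ _ kn))// ler_wpM2l// LM.
Qed.

(** * Convergence of the product formula *)

Unset Implicit Arguments.
Set Strict Implicit.

Theorem theorem3p2 (R : realType) (X : completeNormedModType R)
    (A : operator X) (SA : R -> bounded_operator X) (V : R -> bounded_operator X)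
    (E : R -> R -> bounded_operator X) (U : R -> R -> bounded_operator X)
    (K w M w' alpha : R)
    (hA : generates A SA)
    (hE : forall r, generates (perturb A (V r)) (E r))
    (hK : 1 <= K)
    (hEbound : forall r t, 0 <= t -> opnorm (E r t) <= K * expR (w * t))
    (hwp : well_posed (fun t => perturb A (V t)))
    (hU : evolution_family U)
    (hUsol : solves_NCP (fun t => perturb A (V t)) U)
    (hUbound : forall t s, s <= t -> opnorm (U t s) <= K * expR (w * (t - s)))
    (hM : 1 <= M)
    (hstab : forall t s (n k : nat), s < t -> (0 < n)%N -> (k < n)%N ->
      opnorm (time_ordered_prod k.+1 (fun j =>
        E (s + (2 * j + 1)%:R * (t - s) / (2 * n)%:R) ((t - s) / n%:R)))
      <= M * expR (k.+1%:R * w' * (t - s) / n%:R))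
    (halpha : 0 < alpha <= 1)
    (hholder : forall T : R, 0 < T -> exists L : R, 0 < L /\
      forall t s, - T < t < T -> - T < s < T ->
        opnorm (fun x => V t x - V s x) <= L * `|t - s| `^ alpha) :
  forall t s, s < t -> exists C : R, 1 <= C /\
    forall n : nat, (0 < n)%N ->
      opnorm (fun x => U t s x - time_ordered_prod n (fun k =>
        E (s + (2 * k + 1)%:R * ((t - s) / (2 * n)%:R)) ((t - s) / n%:R)) x)
      <= C / n%:R `^ alpha.
Proof.
move=> t s st.
have [K0 M0] : 0 <= K /\ 0 <= M by split; apply: le_trans ler01 _.
have [a0 _] := andP halpha.
have [|L [L0 VL]] := hholder (`|s| + `|t| + 1).
  by rewrite ltr_wpDl// addr_ge0.
have expR_le r b : 0 <= r <= t - s -> expR (b * r) <= expR (`|b| * (t - s)).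
  move=> /andP[r0 rt]; rewrite ler_expR (le_trans (ler_norm _))// normrM.
  by rewrite (ger0_norm r0) ler_wpM2l.
(* The absolute values make the constants valid for rates of either sign. *)
pose N := K * expR (`|w| * (t - s)).
pose M1 := M * expR (`|w'| * (t - s)).
have N0 : 0 <= N by rewrite mulr_ge0// expR_ge0.
have M10 : 0 <= M1 by rewrite mulr_ge0// expR_ge0.
have ts0 : 0 < t - s by rewrite subr_gt0.
pose D := N * N * N * M1 * L * (t - s) * (t - s) `^ alpha.
have D0 : 0 <= D.
  by rewrite !mulr_ge0 ?powR_ge0 ?(ltW L0) ?(ltW ts0).
exists (1 + D); split; first by rewrite lerDl.
move=> n n0; pose h : R := (t - s) / n%:R.
have nR0 : 0 < n%:R :> R by rewrite ltr0n.
have nh : n%:R * h = t - s by rewrite mulrC divfK// gt_eqF.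
have h0 : 0 < h by rewrite divr_gt0.
have ha : h `^ alpha = (t - s) `^ alpha / n%:R `^ alpha.
  by rewrite -nh powRM ?(ltW h0) ?(ltW nR0)// mulrAC divff ?mul1r ?gt_eqF ?powR_gt0.
have ED : n%:R * (N * (N * (L * h `^ alpha * N) * h) * M1) = D / n%:R `^ alpha.
  by rewrite ha /D -nh; ring.
pose m k : R := s + (2 * k + 1)%:R * ((t - s) / (2 * n)%:R).
pose p (k : nat) : R := s + k%:R * h.
have mE k : m k = p k + h / 2.
  rewrite /m /p natrD !natrM /h; field.
  by rewrite pnatr_eq0 -lt0n.
have pS k : p k.+1 = p k + h by rewrite /p -natr1 mulrDl mul1r addrA.
have pst k : (k <= n)%N -> s <= p k <= t.
  move=> kn; rewrite /p lerDl mulr_ge0 ?(ltW h0)//=.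
  by rewrite -lerBrDl -nh ler_wpM2r ?(ltW h0)// ler_nat.
have UN r q x : s <= q -> q <= r -> r <= t -> `|U r q x| <= N * `|x|.
  move=> sq qr rt; rewrite (le_trans (le_opnorm_bounded _ _))// ler_wpM2r//.
  rewrite (le_trans (hUbound _ _ qr))// ler_wpM2l// expR_le//.
  by apply/andP; split; lra.
have EN q r x : 0 <= r <= t - s -> `|E q r x| <= N * `|x|.
  move=> rts; have /andP[r0 _] := rts.
  rewrite (le_trans (le_opnorm_bounded _ _))// ler_wpM2r//.
  by rewrite (le_trans (hEbound _ _ r0))// ler_wpM2l// expR_le.
apply: opnorm_le => [|x].
  by rewrite mulr_ge0 ?invr_ge0 ?powR_ge0// addr_ge0.
have -> : U t s x = U (p n) (p 0%N) x by rewrite /p nh mul0r addr0 subrKC.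
rewrite (@le_trans _ _ (D / n%:R `^ alpha * `|x|))//; last first.
  by rewrite ler_wpM2r// ler_wpM2r ?invr_ge0 ?powR_ge0// lerDr.
rewrite -ED.
apply: (telescoped_error (L := fun k => E (m k) h)) => //.
- have d0 : 0 <= L * h `^ alpha by rewrite mulr_ge0 ?powR_ge0 ?(ltW L0).
  by rewrite (mulr_ge0 (mulr_ge0 N0 (mulr_ge0 d0 N0)) (ltW h0)).
- by move=> k _; rewrite pS lerDl ltW.
- move=> k y kn; have /andP[sp pt] := pst _ kn.
  have /andP[_ pnt] := pst _ (leqnn n).
  by apply: UN => //; rewrite /p lerD2l ler_wpM2r ?(ltW h0)// ler_nat.
- move=> k y kn; rewrite (le_trans (le_opnorm_time_ordered_prod _ _ _))//.
  (* the stability bound concerns nonempty products; [P_0] is the identity *)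
  rewrite ler_wpM2r//; case: k kn => [|k] kn.
    rewrite (@le_trans _ _ 1)//.
      by apply: opnorm_le => // z; rewrite mul1r.
    rewrite /M1 (le_trans hM)// ler_peMr// -expR0 ler_expR.
    by rewrite mulr_ge0// ltW.
  have -> : (fun j => E (m j) h : X -> X) =
      (fun j => E (s + (2 * j + 1)%:R * (t - s) / (2 * n)%:R) ((t - s) / n%:R)).
    by apply/funext => j; rewrite /m mulrA.
  rewrite (le_trans (hstab _ _ _ _ st n0 (ltnW kn)))// ler_wpM2l//.
  rewrite -mulrA -/h mulrAC mulrC expR_le// mulr_ge0 ?(ltW h0)//=.
  by rewrite -nh ler_wpM2r ?(ltW h0)// ler_nat ltnW.
move=> k y kn.
have /andP[sp pt] := pst _ (ltnW kn).
have /andP[sp1 pt1] := pst _ kn.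
have pB : p k.+1 - p k = h by rewrite pS addrAC subrr add0r.
rewrite -[in X in N * _ * X]pB -[in E _ _]pB.
apply: (evolution_step_defect (hE (m k)) hU hUsol) => //.
- by rewrite pS lerDl ltW.
- by rewrite mulr_ge0 ?powR_ge0 ?(ltW L0).
- move=> r z /andP[r0 rh]; apply: EN; apply/andP; split; lra.
- move=> r z /andP[r0 rh]; apply: UN => //; lra.
move=> r z /andP[r0 rh].
rewrite (le_trans (le_opnorm_sub _ _ _))// ler_wpM2r//.
rewrite pS in rh pt1.
have := ler_norm s; have := ler_norm (- s); have := ler_norm t.
have := ler_norm (- t); rewrite !normrN => t1 t2 s1 s2.
rewrite (le_trans (VL _ _ _ _))//.
- by apply/andP; split; lra.
- by rewrite mE; apply/andP; split; lra.
rewrite ler_wpM2l ?(ltW L0)// ge0_ler_powR ?nnegrE ?(ltW a0) ?(ltW h0)//.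
by rewrite mE ler_norml; apply/andP; split; lra.
Qed.
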